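(* Suppose the plant is exactly the LSTM network \[ \begin{aligned} x^+ &= \sigma_g(W_f u + U_f \xi + b_f)\circ x + \sigma_g(W_i u + U_i \xi + b_i)\circ \sigma_c(W_c u + U_c \xi + b_c),\\ \xi^+ &= \sigma_g(W_o u + U_o \xi + b_o)\circ \sigma_c(x^+),\qquad y = C\xi + b_y, \end{aligned} \] with inputs in $\mathcal{U}=[-u_{\max},u_{\max}]^{n_u}$, and that $\rho(A_\delta)<1$. Consider the observer with state $\hat\chi=(\hat x,\hat\xi)$ and gains $L_f,L_i,L_o\in\mathbb{R}^{n_x\times n_y}$: \[ \begin{aligned} \hat x^+ &= \sigma_g[W_f u + U_f\hat\xi + b_f + L_f(y-\hat y)]\circ\hat x + \sigma_g[W_i u + U_i\hat\xi + b_i + L_i(y-\hat y)]\circ\sigma_c(W_c u + U_c\hat\xi + b_c),\\ \hat\xi^+ &= \sigma_g[W_o u + U_o\hat\xi + b_o + L_o(y-\hat y)]\circ\sigma_c(\hat x^+),\qquad \hat y = C\hat\xi + b_y. \end{aligned} \] Let \[ \hat A=\begin{bmatrix}\hat{\bar\sigma}_g^f & \hat\alpha\\ \hat{\bar\sigma}_g^f\hat{\bar\sigma}_g^o & \tfrac14\bar{\sigma}_c^x\|U_o-L_oC\|+\hat{\bar\sigma}_g^o\hat\alpha\end{bmatrix}. \] If $\rho(\hat A)<1$, then the state estimate converges: $\hat\chi(k)-\chi(k)\to0$ as $k\to\infty$.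
   Context: $\sigma_g(t)=1/(1+e^{-t})$, $\sigma_c=\tanh$, applied entrywise; $\circ$ is the Hadamard product; $\|\cdot\|$ is the induced 2-norm, $\|\cdot\|_\infty$ the induced $\infty$-norm, $\rho$ the spectral radius; $[\cdot\ \cdots\ \cdot]$ is horizontal concatenation. Quantities: $\bar{\sigma}_g^\star=\sigma_g(\|[W_\star u_{\max}\ U_\star\ b_\star]\|_\infty)$ for $\star\in\{f,i,o\}$; $\bar{\sigma}_c^c=\sigma_c(\|[W_c u_{\max}\ U_c\ b_c]\|_\infty)$; $\bar{\sigma}_c^x=\sigma_c(\bar{\sigma}_g^i\bar{\sigma}_c^c/(1-\bar{\sigma}_g^f))$; $\alpha=\tfrac14\|U_f\|\frac{\bar{\sigma}_g^i\bar{\sigma}_c^c}{1-\bar{\sigma}_g^f}+\bar{\sigma}_g^i\|U_c\|+\tfrac14\|U_i\|\bar{\sigma}_c^c$; $A_\delta=\begin{bmatrix}\bar{\sigma}_g^f & \alpha\\ \bar{\sigma}_g^o\bar{\sigma}_g^f & \alpha\bar{\sigma}_g^o+\tfrac14\bar{\sigma}_c^x\|U_o\|\end{bmatrix}$. Observer quantities: $\hat{\bar\sigma}_g^\star=\sigma_g(\|[W_\star u_{\max}\ \ U_\star-L_\star C\ \ b_\star\ \ L_\star C]\|_\infty)$ for $\star\in\{f,i,o\}$; $\hat\alpha=\tfrac14\|U_f-L_fC\|\frac{\bar{\sigma}_g^i\bar{\sigma}_c^c}{1-\bar{\sigma}_g^f}+\bar{\sigma}_g^i\|U_c\|+\tfrac14\|U_i-L_iC\|\bar{\sigma}_c^c$.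 Plant and observer states are taken with $\xi,\hat\xi\in(-1,1)^{n_x}$ and $|x_{(j)}|,|\hat x_{(j)}|$ within the invariant bounds of the respective dynamics. *)

(* Defs.v *)
From HB Require Import structures.
From mathcomp Require Import all_boot all_order all_algebra.
From mathcomp Require Import all_classical all_reals all_analysis.
From mathcomp Require Import complex.
Set Implicit Arguments. Unset Strict Implicit. Unset Printing Implicit Defensive.
Import Order.TTheory GRing.Theory Num.Theory.
Import numFieldNormedType.Exports.
Local Open Scope classical_set_scope.
Local Open Scope ring_scope.

Section Defs.
Variable R : realType.

Definition sigmoid (t : R) : R := 1 / (1 + expR (- t)).
Definition tanhR (t : R) : R := (expR t - expR (- t)) / (expR t + expR (- t)).

Definition sigg {m n} (A : 'M[R]_(m, n)) : 'M[R]_(m, n) := map_mx sigmoid A.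
Definition sigc {m n} (A : 'M[R]_(m, n)) : 'M[R]_(m, n) := map_mx tanhR A.
Definition hadamard {m n} (A B : 'M[R]_(m, n)) : 'M[R]_(m, n) :=
  \matrix_(i, j) (A i j * B i j).

Definition norm_inf {m n} (A : 'M[R]_(m, n)) : R :=
  \big[Num.max/0]_(i < m) \sum_(j < n) `|A i j|.

Definition vnorm2 {n} (v : 'cV[R]_n) : R := Num.sqrt (\sum_(i < n) (v i ord0) ^+ 2).
Definition norm2 {m n} (A : 'M[R]_(m, n)) : R :=
  sup [set vnorm2 (A *m v) | v in [set v : 'cV[R]_n | vnorm2 v <= 1]].

Definition cmod (z : R[i]) : R := Num.sqrt (complex.Re z ^+ 2 + complex.Im z ^+ 2).
Definition spectral_radius {n} (A : 'M[R]_n) : R :=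
  sup [set cmod l | l in
        [set l : R[i] | root (char_poly (map_mx (fun x : R => real_complex R x) A)) l]].

Definition mx2 (a b c d : R) : 'M[R]_2 :=
  \matrix_(i < 2, j < 2)
    (if (i == 0 :> nat) then (if (j == 0 :> nat) then a else b)
     else (if (j == 0 :> nat) then c else d)).

Definition in_box {n} (umax : R) (u : 'cV[R]_n) : Prop :=
  forall i, - umax <= u i ord0 <= umax.

Definition in_open_unit {n} (v : 'cV[R]_n) : Prop :=
  forall i, - 1 < v i ord0 < 1.

Definition in_sup_ball {n} (bnd : R) (v : 'cV[R]_n) : Prop :=
  forall i, `|v i ord0| <= bnd.

Definition lstm_step {nx nu}
  (Wf Wi Wo Wc : 'M[R]_(nx, nu)) (Uf Ui Uo Uc : 'M[R]_nx)
  (bf bi bo bc : 'cV[R]_nx) (u : 'cV[R]_nu) (x xi : 'cV[R]_nx)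
  : 'cV[R]_nx * 'cV[R]_nx :=
  let xp := hadamard (sigg (Wf *m u + Uf *m xi + bf)) x
          + hadamard (sigg (Wi *m u + Ui *m xi + bi)) (sigc (Wc *m u + Uc *m xi + bc)) in
  (xp, hadamard (sigg (Wo *m u + Uo *m xi + bo)) (sigc xp)).

(* one step of the observer, with innovation e = y - yhat *)
Definition obs_step {nx nu ny}
  (Wf Wi Wo Wc : 'M[R]_(nx, nu)) (Uf Ui Uo Uc : 'M[R]_nx)
  (bf bi bo bc : 'cV[R]_nx) (Lf Li Lo : 'M[R]_(nx, ny))
  (u : 'cV[R]_nu) (e : 'cV[R]_ny) (xh xih : 'cV[R]_nx)
  : 'cV[R]_nx * 'cV[R]_nx :=
  let xp := hadamard (sigg (Wf *m u + Uf *m xih + bf + Lf *m e)) xh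
          + hadamard (sigg (Wi *m u + Ui *m xih + bi + Li *m e))
                     (sigc (Wc *m u + Uc *m xih + bc)) in
  (xp, hadamard (sigg (Wo *m u + Uo *m xih + bo + Lo *m e)) (sigc xp)).

Definition sbar_g {nx nu} (umax : R) (W : 'M[R]_(nx, nu)) (U : 'M[R]_nx) (b : 'cV[R]_nx) : R :=
  sigmoid (norm_inf (row_mx (umax *: W) (row_mx U b))).
Definition sbar_c {nx nu} (umax : R) (W : 'M[R]_(nx, nu)) (U : 'M[R]_nx) (b : 'cV[R]_nx) : R :=
  tanhR (norm_inf (row_mx (umax *: W) (row_mx U b))).
Definition shat_g {nx nu ny} (umax : R) (W : 'M[R]_(nx, nu)) (U : 'M[R]_nx) (b : 'cV[R]_nx)
  (L : 'M[R]_(nx, ny)) (C : 'M[R]_(ny, nx)) : R :=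
  sigmoid (norm_inf (row_mx (umax *: W) (row_mx (U - L *m C) (row_mx b (L *m C))))).

End Defs.

(* Main.v *)
Require Import Defs.
From HB Require Import structures.
From mathcomp Require Import all_boot all_order all_algebra.
From mathcomp Require Import all_classical all_reals all_analysis.
From mathcomp Require Import complex ring lra.
Import Order.TTheory GRing.Theory Num.Theory.
Import numFieldNormedType.Exports.
Local Open Scope classical_set_scope.
Local Open Scope ring_scope.

(* The bounds [|xi|, |xih| <= 1] and [|x| <= si * scc / (1 - sf)] are invariant,
   hence every gate stays below its saturation value.  Writing
   f'x' - f x = f' (x' - x) + (f' - f) x for each product, and using that the
   sigmoid is 1/4-Lipschitz and tanh 1-Lipschitz, the pair of Euclidean norms of
   the estimation errors is dominated entrywise by the linear recursion with the
   nonnegative matrix [A_hat].  Its Perron eigenvalue is real and below 1, so some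
   positive weighted sum of the two errors decays geometrically. *)

(** * Monotonicity, bounds and Lipschitz constants of the sigmoid and of tanh *)

Section Activations.
Context {R : realType}.
Implicit Types (s t B k : R) (f df : R -> R).

(** Mean value theorem on the segment between the two points, which are first put in order. *)
Lemma lipschitz_of_derive_bound f df k :
  (forall t, is_derive t 1 f (df t)) -> (forall t, `|df t| <= k) ->
  forall s t, `|f s - f t| <= k * `|s - t|.
Proof.
move=> fdf dfk.
have main s t : s < t -> `|f t - f s| <= k * `|t - s|.
  move=> st.
  have cf : {within `[s, t], continuous f}.
    by apply: derivable_within_continuous => y _; have [] := fdf y.
  have [c _ ->] := @MVT R f df s t st (fun y _ => fdf y) cf.
  by rewrite normrM ler_wpM2r.
move=> s t; case: (ltgtP s t) => [st|ts|->].
- by rewrite distrC (distrC s); exact: main.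
- exact: main.
- by rewrite !subrr normr0 mulr0.
Qed.

(** Here the variable occurs in a single exponential, so that monotonicity can be read off. *)
Lemma tanhRE t : tanhR t = 1 - 2 / (expR (t + t) + 1).
Proof.
have e0 := expR_gt0 t; rewrite /tanhR expRN expRD.
have n1 : expR t != 0 by rewrite gt_eqF.
have n2 : expR t * expR t + 1 != 0 by rewrite gt_eqF// ltr_wpDl// mulr_ge0// ltW.
by field; rewrite n1 n2.
Qed.

Lemma tanhR_le s t : s <= t -> tanhR s <= tanhR t.
Proof.
move=> st; rewrite !tanhRE lerD2l lerN2 ler_pM2l// lef_pV2 ?posrE ?addr_gt0 ?expR_gt0//.
by rewrite lerD2r ler_expR lerD.
Qed.

Lemma tanhRN t : tanhR (- t) = - tanhR t.
Proof. by rewrite /tanhR opprK -mulNr opprB addrC [X in _ / X]addrC. Qed.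

Lemma tanhR0 : tanhR (0 : R) = 0.
Proof. by rewrite /tanhR oppr0 subrr mul0r. Qed.

Lemma tanhR_ge0 t : 0 <= t -> 0 <= tanhR t.
Proof. by move=> t0; rewrite -tanhR0 tanhR_le. Qed.

Lemma normr_tanhR_le B t : `|t| <= B -> `|tanhR t| <= tanhR B.
Proof.
by rewrite !ler_norml -tanhRN => /andP[? ?]; apply/andP; split; apply: tanhR_le.
Qed.

Lemma normr_tanhR_lt1 t : `|tanhR t| < 1.
Proof.
have e1 := expR_gt0 t; have e2 := expR_gt0 (- t).
rewrite /tanhR normrM (gtr0_norm (x := _^-1)) ?invr_gt0 ?addr_gt0//.
by rewrite ltr_pdivrMr ?addr_gt0// mul1r ltr_norml; apply/andP; split; lra.
Qed.

Lemma sigmoid_gt0 t : 0 < sigmoid t.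
Proof. by rewrite divr_gt0// addr_gt0// expR_gt0. Qed.

Lemma sigmoid_lt1 t : sigmoid t < 1.
Proof.
by rewrite /sigmoid ltr_pdivrMr ?addr_gt0 ?expR_gt0// mul1r ltrDl expR_gt0.
Qed.

Lemma sigmoid_le s t : s <= t -> sigmoid s <= sigmoid t.
Proof.
move=> st; rewrite /sigmoid ler_pM2l// lef_pV2 ?posrE ?addr_gt0 ?expR_gt0//.
by rewrite lerD2l ler_expR lerN2.
Qed.

Lemma is_derive_sigmoid t :
  is_derive t 1 (@sigmoid R) (sigmoid t * (1 - sigmoid t)).
Proof.
have e0 := expR_gt0 (- t); have n0 : 1 + expR (- t) != 0 by rewrite gt_eqF// addr_gt0.
have -> : @sigmoid R = fun y => (1 + expR (- y))^-1.
  by apply/funext => y; rewrite /sigmoid div1r.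
have hd : is_derive t 1 (fun y : R => 1 + expR (- y)) (- expR (- t)).
  have hN : is_derive t 1 (fun y : R => - y) (- 1) by exact: is_deriveN.
  have hE := @is_derive1_comp R expR (fun y : R => - y) t _ _ (is_derive_expR (- t)) hN.
  have hD := is_deriveD (is_derive_cst (1 : R) t 1) hE.
  by apply: (is_derive_eq hD); rewrite add0r mulrN1.
have hV := @is_deriveV R (fun y => 1 + expR (- y)) _ _ _ n0 hd; apply: (is_derive_eq hV).
by rewrite /sigmoid /GRing.scale/=; field.
Qed.

Lemma sigmoid_lipschitz s t : `|sigmoid s - sigmoid t| <= 4^-1 * `|s - t|.
Proof.
apply: (lipschitz_of_derive_bound _ _ _ is_derive_sigmoid) => y.
have h0 := sigmoid_gt0 y; have h1 := sigmoid_lt1 y.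
rewrite ger0_norm; last by rewrite mulr_ge0 ?subr_ge0 ?ltW.
(* With [s = sigmoid y], the derivative is [s (1 - s) = 1/4 - (s - 1/2)^2]; hence the constant
   1/4. *)
have : 0 <= (sigmoid y - 2^-1) ^+ 2 by rewrite sqr_ge0.
by nra.
Qed.

(** Up to a shift, tanh is the sigmoid with argument and value both stretched by 2, which turns the
    Lipschitz constant 1/4 into 1. *)
Lemma tanhR_sigmoid t : tanhR t = 2 * sigmoid (t + t) - 1.
Proof.
rewrite tanhRE /sigmoid expRN; have e0 := expR_gt0 (t + t).
have n1 : expR (t + t) != 0 by rewrite gt_eqF.
have n2 : expR (t + t) + 1 != 0 by rewrite gt_eqF// addr_gt0.
by field; rewrite n1 n2.
Qed.

Lemma tanhR_lipschitz s t : `|tanhR s - tanhR t| <= 1 * `|s - t|.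
Proof.
rewrite !tanhR_sigmoid.
have -> : 2 * sigmoid (s + s) - 1 - (2 * sigmoid (t + t) - 1)
        = 2 * (sigmoid (s + s) - sigmoid (t + t)) by ring.
rewrite normrM ger0_norm//.
have := sigmoid_lipschitz (s + s) (t + t).
have -> : s + s - (t + t) = 2 * (s - t) by ring.
by rewrite normrM (ger0_norm (x := 2))//; lra.
Qed.

End Activations.

(** * The Euclidean norm and the operator norm it induces *)

Section EuclideanNorm.
Context {R : realType}.

Lemma sqr_sum_mul_le n (a b : 'I_n -> R) :
  (\sum_i a i * b i) ^+ 2 <= (\sum_i a i ^+ 2) * (\sum_i b i ^+ 2).
Proof.
(* Lagrange: the difference is half the sum of the squares of the 2x2 minors. *)
have key : 0 <= \sum_i \sum_j (a i * b j - a j * b i) ^+ 2.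
  by do 2![apply: sumr_ge0 => ? _]; exact: sqr_ge0.
suff E : \sum_i \sum_j (a i * b j - a j * b i) ^+ 2
    = 2 * ((\sum_i a i ^+ 2) * (\sum_i b i ^+ 2) - (\sum_i a i * b i) ^+ 2).
  by move: key; rewrite E pmulr_rge0// subr_ge0.
have -> : \sum_i \sum_j (a i * b j - a j * b i) ^+ 2
   = \sum_i \sum_j (a i ^+ 2 * b j ^+ 2) + \sum_i \sum_j (b i ^+ 2 * a j ^+ 2)
     - 2 * \sum_i \sum_j ((a i * b i) * (a j * b j)).
  rewrite mulr_sumr -sumrN -!big_split/=; apply: eq_bigr => i _.
  rewrite mulr_sumr -sumrN -!big_split/=; apply: eq_bigr => j _.
  by ring.
by rewrite -!big_distrlr/=; ring.
Qed.

Lemma vnorm2_ge0 {n} (v : 'cV[R]_n) : 0 <= vnorm2 v.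
Proof. exact: sqrtr_ge0. Qed.

Lemma sqr_vnorm2 {n} (v : 'cV[R]_n) : vnorm2 v ^+ 2 = \sum_i v i ord0 ^+ 2.
Proof. by rewrite sqr_sqrtr// sumr_ge0// => i _; exact: sqr_ge0. Qed.

(** After squaring, only the cross terms remain to be compared, and Cauchy-Schwarz
    ([sqr_sum_mul_le]) does that. *)
Lemma vnorm2_triangle {n} (v w : 'cV[R]_n) : vnorm2 (v + w) <= vnorm2 v + vnorm2 w.
Proof.
rewrite -ler_sqr ?nnegrE ?addr_ge0 ?vnorm2_ge0// sqrrD !sqr_vnorm2.
have -> : \sum_i (v + w) i ord0 ^+ 2 = \sum_i v i ord0 ^+ 2 +
    (\sum_i v i ord0 * w i ord0) *+ 2 + \sum_i w i ord0 ^+ 2.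
  rewrite -sumrMnl -!big_split/=; apply: eq_bigr => i _.
  by rewrite mxE sqrrD.
rewrite lerD2r lerD2l lerMn2r/=.
rewrite (le_trans (ler_norm _))//.
rewrite -ler_sqr ?nnegrE ?mulr_ge0 ?vnorm2_ge0// (real_normK (num_real _)) exprMn !sqr_vnorm2.
exact: sqr_sum_mul_le.
Qed.

Lemma vnorm2_le_scale {n} (c : R) (v w : 'cV[R]_n) : 0 <= c ->
  (forall i, `|v i ord0| <= c * `|w i ord0|) -> vnorm2 v <= c * vnorm2 w.
Proof.
move=> c0 vw.
rewrite -ler_sqr ?nnegrE ?mulr_ge0 ?vnorm2_ge0// exprMn !sqr_vnorm2 mulr_sumr.
apply: ler_sum => i _; rewrite -(real_normK (num_real (v i ord0))) -(real_normK (num_real (w i ord0))) -exprMn.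
by rewrite ler_sqr ?nnegrE ?mulr_ge0.
Qed.

Lemma normr_entry_le_vnorm2 {n} (v : 'cV[R]_n) i : `|v i ord0| <= vnorm2 v.
Proof.
rewrite -ler_sqr ?nnegrE ?vnorm2_ge0// (real_normK (num_real _)) sqr_vnorm2 (bigD1 i)//= lerDl.
by apply: sumr_ge0 => j _; exact: sqr_ge0.
Qed.

(** Convergence of column vectors refers to the entrywise maximum norm, while the error estimates
    are Euclidean; this bound passes from the second to the first. *)
Lemma mx_norm_le_vnorm2 {n} (v : 'cV[R]_n) : `|v| <= vnorm2 v.
Proof.
rewrite /Num.norm/= mx_normrE; apply: bigmax_le => [|[i j] _]; first exact: vnorm2_ge0.
by rewrite (ord1 j) normr_entry_le_vnorm2.
Qed.

Lemma vnorm2Z {n} (c : R) (v : 'cV[R]_n) : vnorm2 (c *: v) = `|c| * vnorm2 v.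
Proof.
rewrite /vnorm2 -sqrtr_sqr -sqrtrM ?sqr_ge0//; congr Num.sqrt.
by rewrite mulr_sumr; apply: eq_bigr => i _; rewrite mxE exprMn.
Qed.

Lemma vnorm2_eq0 {n} (v : 'cV[R]_n) : vnorm2 v = 0 -> v = 0.
Proof.
move=> v0; apply/matrixP => i j; rewrite (ord1 j) mxE; apply/eqP.
by rewrite -normr_le0 -v0 normr_entry_le_vnorm2.
Qed.

Lemma vnorm2_0 {n} : vnorm2 (0 : 'cV[R]_n) = 0.
Proof. by rewrite -(scale0r 0) vnorm2Z normr0 mul0r. Qed.

(** A [sup] dominates the elements of its set only if the set is bounded, so the estimates with
    [norm2] rest on this. *)
Lemma norm2_has_ubound {m n} (A : 'M[R]_(m, n)) :
  has_ubound [set vnorm2 (A *m v) | v in [set v : 'cV[R]_n | vnorm2 v <= 1]].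
Proof.
(* On the unit ball the entries of [v] are at most 1 in absolute value, so the absolute row sums of
   [A] dominate [A *m v] entrywise. *)
pose w : 'cV[R]_m := \col_i \sum_j `|A i j|.
exists (1 * vnorm2 w) => _ [v /= v1 <-]; apply: vnorm2_le_scale => // i.
rewrite mul1r !mxE (le_trans (ler_norm_sum _ _ _))// (le_trans _ (ler_norm _))//.
apply: ler_sum => j _; rewrite normrM -[leRHS]mulr1 ler_wpM2l//.
exact: le_trans (normr_entry_le_vnorm2 _ _) v1.
Qed.

Lemma norm2_ge0 {m n} (A : 'M[R]_(m, n)) : 0 <= norm2 A.
Proof.
apply: le_trans (ub_le_sup (norm2_has_ubound A) _); last first.
  by exists 0 => //=; rewrite vnorm2_0.
exact: vnorm2_ge0.
Qed.

Lemma vnorm2_mulmx_le {m n} (A : 'M[R]_(m, n)) (v : 'cV[R]_n) :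
  vnorm2 (A *m v) <= norm2 A * vnorm2 v.
Proof.
(* The zero vector cannot be normalised and is treated apart. *)
have [v0|vn0] := eqVneq (vnorm2 v) 0.
  by rewrite (vnorm2_eq0 _ v0) mulmx0 !vnorm2_0 mulr0.
have vp : 0 < vnorm2 v by rewrite lt_neqAle eq_sym vn0 vnorm2_ge0.
rewrite -ler_pdivrMr// mulrC.
have -> : (vnorm2 v)^-1 * vnorm2 (A *m v) = vnorm2 (A *m ((vnorm2 v)^-1 *: v)).
  by rewrite -scalemxAr vnorm2Z ger0_norm// invr_ge0 ltW.
apply: ub_le_sup; first exact: norm2_has_ubound.
exists ((vnorm2 v)^-1 *: v) => //=.
by rewrite vnorm2Z ger0_norm ?mulVf// invr_ge0 ltW.
Qed.

Lemma vnorm2_hadamard_le {n} (B : R) (a v : 'cV[R]_n) : 0 <= B ->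
  in_sup_ball B a -> vnorm2 (hadamard a v) <= B * vnorm2 v.
Proof.
move=> B0 aB; apply: vnorm2_le_scale => // i.
by rewrite mxE normrM ler_wpM2r.
Qed.

Lemma vnorm2_map_lipschitz {n} (f : R -> R) (k : R) (v w : 'cV[R]_n) : 0 <= k ->
  (forall s t, `|f s - f t| <= k * `|s - t|) ->
  vnorm2 (map_mx f v - map_mx f w) <= k * vnorm2 (v - w).
Proof.
by move=> k0 fk; apply: vnorm2_le_scale => // i; rewrite !mxE.
Qed.

End EuclideanNorm.

(** * Spectral radius of a nonnegative 2x2 matrix and the linear recursions it controls *)

Section SpectralRadius.
Context {R : realType}.

Lemma cmod_real (t : R) : cmod (real_complex R t) = `|t|.
Proof. by rewrite /cmod /= expr0n addr0 sqrtr_sqr. Qed.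

Lemma cmod_root_le_spectral_radius n (A : 'M[R]_n) (l : R[i]) :
  root (char_poly (map_mx (real_complex R) A)) l -> cmod l <= spectral_radius A.
Proof.
move=> rl; apply: ub_le_sup; last by exists l.
set p := char_poly _ in rl *.
have [rs ps] := closed_field_poly_normal p.
(* The characteristic polynomial splits, so the sum of the moduli of its listed roots bounds each of
   them. *)
exists (\sum_(z <- rs) cmod z) => _ [z /= rz <-].
have zrs : z \in rs.
  move: rz; rewrite ps rootZ ?root_prod_XsubC//.
  by rewrite lead_coef_eq0 monic_neq0// char_poly_monic.
rewrite (big_rem z zrs)/= lerDl; apply: sumr_ge0 => y _.
exact: sqrtr_ge0.
Qed.

Lemma char_poly_mx2 (a b c d : R) :
  char_poly (mx2 a b c d) = ('X - a%:P) * ('X - d%:P) - (b * c)%:P.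
Proof.
rewrite /char_poly (expand_det_row _ ord0) !big_ord_recl big_ord0 /cofactor.
rewrite !det_mx11 !mxE /= /bump /= !mulr1n !mulr0n.
by rewrite polyCM; ring.
Qed.

(** The hypothesis is the characteristic equation, read at a real number. *)
Lemma normr_root_le_spectral_radius_mx2 (a b c d l : R) :
  (l - a) * (l - d) = b * c -> `|l| <= spectral_radius (mx2 a b c d).
Proof.
move=> hl; rewrite -cmod_real; apply: cmod_root_le_spectral_radius.
rewrite -map_char_poly /= fmorph_root char_poly_mx2 /root !hornerE.
by rewrite hl subrr.
Qed.

(** As [b * c >= 0], the discriminant is nonnegative and the larger eigenvalue [l] is real, below 1
    and at least [a] and [d]. Moving from [l] up to [r] only increases
    [(l - a) * (l - d) = b * c]. *)
Lemma spectral_radius_mx2_contraction_rate (a b c d : R) :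
  0 <= a -> 0 <= b -> 0 <= c -> 0 <= d -> spectral_radius (mx2 a b c d) < 1 ->
  exists r : R, [/\ r < 1, a < r, d < r & b * c <= (r - a) * (r - d)].
Proof.
move=> a0 b0 c0 d0 rho.
pose s := Num.sqrt ((a - d) ^+ 2 + 4 * (b * c)).
have bc0 : 0 <= b * c by rewrite mulr_ge0.
have s2 : s ^+ 2 = (a - d) ^+ 2 + 4 * (b * c).
  by rewrite sqr_sqrtr// addr_ge0 ?sqr_ge0 ?mulr_ge0.
have s_ge : `|a - d| <= s.
  by rewrite -sqrtr_sqr ler_wsqrtr// lerDl mulr_ge0.
have [s1 s3] : a - d <= s /\ d - a <= s.
  by move: s_ge; rewrite ler_norml => /andP[? ?]; split; lra.
pose l := (a + d + s) / 2.
have ll : (l - a) * (l - d) = b * c.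
  have -> : (l - a) * (l - d) = (s ^+ 2 - (a - d) ^+ 2) / 4 by rewrite /l; field.
  by rewrite s2; field.
have l1 : l < 1.
  have := normr_root_le_spectral_radius_mx2 _ _ _ _ _ ll.
  by move=> /(le_trans (ler_norm _)) /le_lt_trans; apply.
have la : a <= l by rewrite /l; lra.
have ld : d <= l by rewrite /l; lra.
(* The midpoint of [l] and 1 lies strictly above [a] and [d] even if [l] equals one of them, as
   happens when [b * c = 0]. *)
exists ((l + 1) / 2); split; [lra|lra|lra|].
by rewrite -ll ler_pM//; lra.
Qed.

(* The weights [c + r - d] and [b + r - a] make the weighted sum of the two
   sequences contract by the factor [r]. *)
Lemma mx2_comparison (a b c d : R) (p q : nat -> R) :
  0 <= a -> 0 <= b -> 0 <= c -> 0 <= d -> spectral_radius (mx2 a b c d) < 1 ->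
  (forall k, 0 <= p k) -> (forall k, 0 <= q k) ->
  (forall k, p k.+1 <= a * p k + b * q k) ->
  (forall k, q k.+1 <= c * p k + d * q k) ->
  p @ \oo --> (0 : R) /\ q @ \oo --> (0 : R).
Proof.
move=> a0 b0 c0 d0 rho p0 q0 pS qS.
have [r [r1 ar dr bcr]] := spectral_radius_mx2_contraction_rate _ _ _ _ a0 b0 c0 d0 rho.
pose w1 := c + (r - d); pose w2 := b + (r - a).
have w1p : 0 < w1 by rewrite /w1; lra.
have w2p : 0 < w2 by rewrite /w2; lra.
(* In [h1] and in [h2], right side minus left side equals [(r - a) * (r - d) - b * c]. *)
have h1 : w1 * a + w2 * c <= r * w1 by rewrite /w1 /w2; nra.
have h2 : w1 * b + w2 * d <= r * w2 by rewrite /w1 /w2; nra.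
pose V k := w1 * p k + w2 * q k.
have VS k : V k.+1 <= r * V k.
  have e1 : w1 * p k.+1 <= w1 * (a * p k + b * q k) by rewrite ler_pM2l.
  have e2 : w2 * q k.+1 <= w2 * (c * p k + d * q k) by rewrite ler_pM2l.
  have e3 := ler_wpM2r (p0 k) h1; have e4 := ler_wpM2r (q0 k) h2.
  by rewrite /V; nra.
have r0 : 0 <= r by lra.
have Vk k : V k <= geometric (V 0%N) r k.
  elim: k => [|k IH]; first by rewrite /geometric/= expr0 mulr1.
  rewrite (le_trans (VS k))// /geometric/= exprS mulrCA ler_wpM2l//.
have gcv : geometric (V 0%N) r @ \oo --> (0 : R).
  by apply: cvg_geometric; rewrite ger0_norm.
(* A weighted sequence below [V] is squeezed between 0 and a multiple of the geometric sequence. *)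
have cv0 (w : R) (z : nat -> R) : 0 < w -> (forall k, 0 <= z k) ->
    (forall k, w * z k <= V k) -> z @ \oo --> (0 : R).
  move=> wp z0 zV.
  have gw : w^-1 * geometric (V 0%N) r k @[k --> \oo] --> (0 : R).
    by rewrite -[X in _ --> X](mulr0 w^-1); apply: cvgMr.
  apply: (squeeze_cvgr _ _ gw); last exact: cvg_cst.
  near=> k; rewrite z0/= mulrC ler_pdivlMr// mulrC.
  exact: le_trans (zV k) (Vk k).
split; [apply: (cv0 w1)|apply: (cv0 w2)] => // k; rewrite /V.
  by rewrite lerDl mulr_ge0// ltW.
by rewrite lerDr mulr_ge0// ltW.
Unshelve. all: by end_near.
Qed.

End SpectralRadius.

(** * Saturation bounds and error estimates for the gates *)

Section LSTM.
Context {R : realType}.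

Lemma in_open_unit_sup_ball {n} (v : 'cV[R]_n) : in_open_unit v -> in_sup_ball 1 v.
Proof. by move=> v1 i; rewrite ltW// ltr_norml. Qed.

Lemma in_box_sup_ball {n} (B : R) (v : 'cV[R]_n) : in_box B v -> in_sup_ball B v.
Proof. by move=> vB i; rewrite ler_norml. Qed.

Lemma norm_inf_ge0 {m n} (A : 'M[R]_(m, n)) : 0 <= norm_inf A.
Proof. exact: bigmax_ge_id. Qed.

Lemma row_sum_le_norm_inf {m n} (A : 'M[R]_(m, n)) i :
  \sum_j `|A i j| <= norm_inf A.
Proof. exact: (le_bigmax 0 (fun i => \sum_j `|A i j|)). Qed.

Lemma row_sum_row_mx {m n p} (A : 'M[R]_(m, n)) (B : 'M[R]_(m, p)) i :
  \sum_j `|row_mx A B i j| = \sum_j `|A i j| + \sum_j `|B i j|.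
Proof.
by rewrite big_split_ord/=; congr (_ + _); apply: eq_bigr => j _;
  rewrite ?row_mxEl ?row_mxEr.
Qed.

(** The bound [B] is kept inside the matrix to match the block [umax *: W]; the state blocks use
    [B = 1]. *)
Lemma normr_mulmx_le {m n} (B : R) (A : 'M[R]_(m, n)) (v : 'cV[R]_n) i :
  in_sup_ball B v -> `|(A *m v) i ord0| <= \sum_j `|(B *: A) i j|.
Proof.
move=> vB; rewrite mxE (le_trans (ler_norm_sum _ _ _))//; apply: ler_sum => j _.
by rewrite mxE !normrM mulrC ler_wpM2r// (le_trans (vB j))// ler_norm.
Qed.

Lemma normr_gate_le {nx nu} (umax : R) (W : 'M[R]_(nx, nu)) (U : 'M[R]_nx)
    (b : 'cV[R]_nx) (u : 'cV[R]_nu) (xi : 'cV[R]_nx) :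
  in_sup_ball umax u -> in_sup_ball 1 xi ->
  in_sup_ball (norm_inf (row_mx (umax *: W) (row_mx U b))) (W *m u + U *m xi + b).
Proof.
move=> hu hxi i; rewrite (le_trans _ (row_sum_le_norm_inf _ i))// !row_sum_row_mx.
rewrite big_ord1 addrA 2!mxE (le_trans (ler_normD _ _))// lerD2r.
rewrite (le_trans (ler_normD _ _))// lerD//; first exact: normr_mulmx_le.
by have := normr_mulmx_le 1 U xi i hxi; rewrite scale1r.
Qed.

(** Regrouping the innovation as [(U - L C) xih + (L C) xi] gives one term for each block of the
    concatenated matrix. *)
Lemma normr_obs_gate_le {nx nu ny} (umax : R) (W : 'M[R]_(nx, nu)) (U : 'M[R]_nx)
    (b : 'cV[R]_nx) (L : 'M[R]_(nx, ny)) (C : 'M[R]_(ny, nx))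
    (u : 'cV[R]_nu) (xi xih : 'cV[R]_nx) :
  in_sup_ball umax u -> in_sup_ball 1 xi -> in_sup_ball 1 xih ->
  in_sup_ball
    (norm_inf (row_mx (umax *: W) (row_mx (U - L *m C) (row_mx b (L *m C)))))
    (W *m u + U *m xih + b + L *m (C *m (xi - xih))).
Proof.
move=> hu hxi hxih i.
have -> : W *m u + U *m xih + b + L *m (C *m (xi - xih))
        = W *m u + (U - L *m C) *m xih + b + L *m C *m xi.
  rewrite mulmxA mulmxBr mulmxBl; apply/matrixP => k l; rewrite !mxE; ring.
rewrite (le_trans _ (row_sum_le_norm_inf _ i))// !row_sum_row_mx.
rewrite big_ord1 !addrA 3!mxE (le_trans (ler_normD _ _))// lerD//; last first.
  by have := normr_mulmx_le 1 (L *m C) xi i hxi; rewrite scale1r.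
rewrite (le_trans (ler_normD _ _))// lerD2r (le_trans (ler_normD _ _))// lerD//.
  exact: normr_mulmx_le.
by have := normr_mulmx_le 1 (U - L *m C) xih i hxih; rewrite scale1r.
Qed.

Lemma sigg_in_sup_ball {n} (B : R) (v : 'cV[R]_n) :
  in_sup_ball B v -> in_sup_ball (sigmoid B) (sigg v).
Proof.
move=> vB i; rewrite mxE gtr0_norm ?sigmoid_gt0// sigmoid_le//.
exact: le_trans (ler_norm _) (vB i).
Qed.

Lemma sigc_in_sup_ball {n} (B : R) (v : 'cV[R]_n) :
  in_sup_ball B v -> in_sup_ball (tanhR B) (sigc v).
Proof. by move=> vB i; rewrite mxE normr_tanhR_le. Qed.

Lemma output_in_sup_ball {n} (v w : 'cV[R]_n) :
  in_sup_ball 1 (hadamard (sigg v) (sigc w)).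
Proof.
move=> i; rewrite !mxE normrM gtr0_norm ?sigmoid_gt0//.
rewrite -[leRHS]mulr1 ler_pM ?(ltW (sigmoid_gt0 _))// ltW ?sigmoid_lt1//.
exact: normr_tanhR_lt1.
Qed.

(* [si * sc / (1 - sf)] is the fixed point of [B |-> sf * B + si * sc]. *)
Lemma cell_in_sup_ball {n} (sf si sc : R) (f i c x : 'cV[R]_n) :
  0 <= sf < 1 -> 0 <= si -> in_sup_ball sf f -> in_sup_ball si i ->
  in_sup_ball sc c -> in_sup_ball (si * sc / (1 - sf)) x ->
  in_sup_ball (si * sc / (1 - sf)) (hadamard f x + hadamard i c).
Proof.
move=> /andP[sf0 sf1] si0 hf hi hc hx j; rewrite !mxE.
have n1 : 1 - sf != 0 by rewrite subr_eq0 gt_eqF.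
have -> : si * sc / (1 - sf) = sf * (si * sc / (1 - sf)) + si * sc by field.
by rewrite (le_trans (ler_normD _ _))// lerD// normrM ler_pM.
Qed.

Lemma sigg_diff_le {n} (U : 'M[R]_n) (v w z : 'cV[R]_n) :
  v - w = U *m z -> vnorm2 (sigg v - sigg w) <= 4^-1 * norm2 U * vnorm2 z.
Proof.
move=> vw; rewrite (le_trans (vnorm2_map_lipschitz _ 4^-1 _ _ _ _))//.
  exact: sigmoid_lipschitz.
by rewrite vw -mulrA ler_wpM2l// vnorm2_mulmx_le.
Qed.

Lemma sigc_diff_le {n} (v w : 'cV[R]_n) :
  vnorm2 (sigc v - sigc w) <= vnorm2 (v - w).
Proof.
rewrite (le_trans (vnorm2_map_lipschitz _ 1 _ _ _ _)) ?mul1r//.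
exact: tanhR_lipschitz.
Qed.

(** In [a' v' - a v = a' (v' - v) + v (a' - a)] the coefficients are one primed and one unprimed
    factor; so an observer gate can multiply the state error and the plant state the gate error. *)
Lemma hadamard_diff_le {n} (B B' : R) (a a' v v' : 'cV[R]_n) :
  0 <= B -> 0 <= B' -> in_sup_ball B a' -> in_sup_ball B' v ->
  vnorm2 (hadamard a' v' - hadamard a v)
    <= B * vnorm2 (v' - v) + B' * vnorm2 (a' - a).
Proof.
move=> B0 B'0 ha hv.
have -> : hadamard a' v' - hadamard a v
        = hadamard a' (v' - v) + hadamard v (a' - a).
  by apply/matrixP => i j; rewrite !mxE; ring.
by rewrite (le_trans (vnorm2_triangle _ _))// lerD// vnorm2_hadamard_le.
Qed.

(** Input and bias cancel, so the gains enter the error only through [U - L *m C]. *)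
Lemma gate_innovation {nx nu ny} (W : 'M[R]_(nx, nu)) (U : 'M[R]_nx)
    (b : 'cV[R]_nx) (L : 'M[R]_(nx, ny)) (C : 'M[R]_(ny, nx))
    (u : 'cV[R]_nu) (xi xih : 'cV[R]_nx) :
  W *m u + U *m xih + b + L *m (C *m (xi - xih)) - (W *m u + U *m xi + b)
    = (U - L *m C) *m (xih - xi).
Proof.
rewrite mulmxA mulmxBl !mulmxBr.
by apply/matrixP => k l; rewrite !mxE; ring.
Qed.

Lemma cvg0_vnorm2 {n} (v : nat -> 'cV[R]_n) :
  (fun k => vnorm2 (v k)) @ \oo --> (0 : R) -> v @ \oo --> (0 : 'cV[R]_n).
Proof.
move=> /cvgr0Pnorm_lt v0; apply/cvgr0Pnorm_lt => e e0.
apply: filterS (v0 _ e0) => k; rewrite ger0_norm ?vnorm2_ge0//.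
exact: le_lt_trans (mx_norm_le_vnorm2 _).
Qed.

End LSTM.

(** * The two error inequalities and the convergence of the estimate *)

Theorem theorem3 (R : realType) (nx nu ny : nat) (umax : R)
  (Wf Wi Wo Wc : 'M[R]_(nx, nu)) (Uf Ui Uo Uc : 'M[R]_nx)
  (bf bi bo bc : 'cV[R]_nx) (C : 'M[R]_(ny, nx)) (by_ : 'cV[R]_ny)
  (Lf Li Lo : 'M[R]_(nx, ny))
  (u : nat -> 'cV[R]_nu) (x xi xh xih : nat -> 'cV[R]_nx) :
  let sf := sbar_g umax Wf Uf bf in
  let si := sbar_g umax Wi Ui bi in
  let so := sbar_g umax Wo Uo bo in
  let scc := sbar_c umax Wc Uc bc in
  let sx := tanhR (si * scc / (1 - sf)) in
  let alpha := 4^-1 * norm2 Uf * (si * scc / (1 - sf)) + si * norm2 Uc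
               + 4^-1 * norm2 Ui * scc in
  let A_delta := mx2 sf alpha (so * sf) (alpha * so + 4^-1 * sx * norm2 Uo) in
  let hsf := shat_g umax Wf Uf bf Lf C in
  let hsi := shat_g umax Wi Ui bi Li C in
  let hso := shat_g umax Wo Uo bo Lo C in
  let halpha := 4^-1 * norm2 (Uf - Lf *m C) * (si * scc / (1 - sf)) + si * norm2 Uc
                + 4^-1 * norm2 (Ui - Li *m C) * scc in
  let A_hat := mx2 hsf halpha (hsf * hso)
                   (4^-1 * sx * norm2 (Uo - Lo *m C) + hso * halpha) in
  (* inputs in U = [-umax, umax]^nu *)
  (forall k, in_box umax (u k)) ->
  (* plant: LSTM network, y = C xi + b_y *)
  (forall k, (x k.+1, xi k.+1) =
             lstm_step Wf Wi Wo Wc Uf Ui Uo Uc bf bi bo bc (u k) (x k) (xi k)) ->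
  (* observer, innovation y - yhat = (C xi + b_y) - (C xih + b_y) *)
  (forall k, (xh k.+1, xih k.+1) =
             obs_step Wf Wi Wo Wc Uf Ui Uo Uc bf bi bo bc Lf Li Lo (u k)
               ((C *m xi k + by_) - (C *m xih k + by_)) (xh k) (xih k)) ->
  (* initial states in the invariant sets *)
  in_open_unit (xi 0%N) -> in_open_unit (xih 0%N) ->
  in_sup_ball (si * scc / (1 - sf)) (x 0%N) ->
  in_sup_ball (hsi * scc / (1 - hsf)) (xh 0%N) ->
  spectral_radius A_delta < 1 ->
  spectral_radius A_hat < 1 ->
  (fun k => xh k - x k) @ \oo --> (0 : 'cV[R]_nx) /\
  (fun k => xih k - xi k) @ \oo --> (0 : 'cV[R]_nx).
Proof.
move=> sf si so scc sx alpha A_delta hsf hsi hso halpha A_hat hbox plant obs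
  xi0 xih0 x0 _ _ rho.
have hu k : in_sup_ball umax (u k) by exact: in_box_sup_ball.
(* After the first step the bound comes from the form of the output, a sigmoid times a tanh,
   whatever the previous state. *)
have xiB k : in_sup_ball 1 (xi k).
  case: k => [|k]; first exact: in_open_unit_sup_ball.
  by case: (plant k) => _ ->; exact: output_in_sup_ball.
have xihB k : in_sup_ball 1 (xih k).
  case: k => [|k]; first exact: in_open_unit_sup_ball.
  by case: (obs k) => _ ->; exact: output_in_sup_ball.
have sf_itv : 0 <= sf < 1 by rewrite ltW ?sigmoid_gt0 ?sigmoid_lt1.
have si0 : 0 <= si by rewrite ltW ?sigmoid_gt0.
have hsf0 : 0 <= hsf by rewrite ltW ?sigmoid_gt0.
have hso0 : 0 <= hso by rewrite ltW ?sigmoid_gt0.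
have scc0 : 0 <= scc by rewrite tanhR_ge0// norm_inf_ge0.
set B := si * scc / (1 - sf).
have B0 : 0 <= B.
  by apply: divr_ge0; [exact: mulr_ge0 | rewrite subr_ge0; case/andP: sf_itv => _ /ltW].
have sx0 : 0 <= sx by exact: tanhR_ge0.
have quarter_norm2_ge0 (U : 'M[R]_nx) : 0 <= 4^-1 * norm2 U.
  by rewrite mulr_ge0 ?norm2_ge0.
have halpha0 : 0 <= halpha.
  exact: addr_ge0 (addr_ge0 (mulr_ge0 (quarter_norm2_ge0 _) B0)
    (mulr_ge0 si0 (norm2_ge0 _))) (mulr_ge0 (quarter_norm2_ge0 _) scc0).
have xB k : in_sup_ball B (x k).
  elim: k => [//|k IH]; case: (plant k) => -> _.
  apply: cell_in_sup_ball => //.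
  - by apply: sigg_in_sup_ball; exact: normr_gate_le.
  - by apply: sigg_in_sup_ball; exact: normr_gate_le.
  - by apply: sigc_in_sup_ball; exact: normr_gate_le.
have innov k : (C *m xi k + by_) - (C *m xih k + by_) = C *m (xi k - xih k).
  by rewrite mulmxBr opprD addrACA subrr addr0.
pose p k := vnorm2 (xh k - x k); pose q k := vnorm2 (xih k - xi k).
have p0 k : 0 <= p k by exact: vnorm2_ge0.
have q0 k : 0 <= q k by exact: vnorm2_ge0.
have pS k : p k.+1 <= hsf * p k + halpha * q k.
  rewrite /p; case: (plant k) => -> _; case: (obs k) => -> _.
  rewrite innov opprD addrACA (le_trans (vnorm2_triangle _ _))//.
  set ff := sigg (_ + Lf *m _); set fi := sigg (_ + Li *m _).
  set gf := sigg (Wf *m _ + _ + _); set gi := sigg (Wi *m _ + _ + _).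
  set ch := sigc (_ + Uc *m xih k + _); set cc := sigc (_ + Uc *m xi k + _).
  have e1 : vnorm2 (hadamard ff (xh k) - hadamard gf (x k))
      <= hsf * p k + B * vnorm2 (ff - gf).
    apply: hadamard_diff_le => //.
    by apply: sigg_in_sup_ball; exact: normr_obs_gate_le.
  have e2 : vnorm2 (hadamard fi ch - hadamard gi cc)
      <= scc * vnorm2 (fi - gi) + si * vnorm2 (ch - cc).
    (* The factors are swapped so that the bounds are taken on [ch] and on the plant gate [gi]: this
       yields [scc] and [si] as in [halpha], where the other order would yield [hsi]. *)
    have -> : hadamard fi ch - hadamard gi cc = hadamard ch fi - hadamard cc gi.
      by apply/matrixP => i j; rewrite !mxE; ring.
    apply: hadamard_diff_le => //.
      by apply: sigc_in_sup_ball; exact: normr_gate_le.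
    by apply: sigg_in_sup_ball; exact: normr_gate_le.
  have e3 : vnorm2 (ff - gf) <= 4^-1 * norm2 (Uf - Lf *m C) * q k.
    by apply: sigg_diff_le; exact: gate_innovation.
  have e4 : vnorm2 (fi - gi) <= 4^-1 * norm2 (Ui - Li *m C) * q k.
    by apply: sigg_diff_le; exact: gate_innovation.
  have e5 : vnorm2 (ch - cc) <= norm2 Uc * q k.
    rewrite (le_trans (sigc_diff_le _ _))// (le_trans _ (vnorm2_mulmx_le _ _))//.
    rewrite mulmxBr opprD addrACA subrr addr0 opprD addrACA subrr add0r.
    exact: lexx.
  rewrite (le_trans (lerD e1 e2))//.
  have -> : hsf * p k + halpha * q k
    = hsf * p k + B * (4^-1 * norm2 (Uf - Lf *m C) * q k)
      + (scc * (4^-1 * norm2 (Ui - Li *m C) * q k) + si * (norm2 Uc * q k)).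
    by rewrite /halpha -/B; ring.
  by rewrite !lerD// ler_wpM2l.
have qS k : q k.+1 <= hsf * hso * p k
    + (4^-1 * sx * norm2 (Uo - Lo *m C) + hso * halpha) * q k.
  have xpB := xB k.+1; have pk := pS k; rewrite /p in pk.
  rewrite /q; case: (plant k) => xE ->; case: (obs k) => xhE ->.
  (* The output uses the updated cell state. Folding it back to time [k.+1] lets [pS] bound its
     error, whence the factor [hso] on the first row of [A_hat] in the second row. *)
  rewrite -xE -xhE innov.
  set fo := sigg (_ + Lo *m _); set go := sigg (Wo *m _ + _ + _).
  have e1 : vnorm2 (hadamard fo (sigc (xh k.+1)) - hadamard go (sigc (x k.+1)))
      <= hso * vnorm2 (sigc (xh k.+1) - sigc (x k.+1)) + sx * vnorm2 (fo - go).
    apply: hadamard_diff_le => //; last exact: sigc_in_sup_ball.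
    by apply: sigg_in_sup_ball; exact: normr_obs_gate_le.
  have e2 : vnorm2 (fo - go) <= 4^-1 * norm2 (Uo - Lo *m C) * q k.
    by apply: sigg_diff_le; exact: gate_innovation.
  have e3 := le_trans (sigc_diff_le _ _) pk.
  rewrite (le_trans e1)//.
  have -> : hsf * hso * p k
      + (4^-1 * sx * norm2 (Uo - Lo *m C) + hso * halpha) * q k
    = hso * (hsf * p k + halpha * q k)
      + sx * (4^-1 * norm2 (Uo - Lo *m C) * q k) by ring.
  by rewrite lerD// ler_wpM2l.
have dhat0 : 0 <= 4^-1 * sx * norm2 (Uo - Lo *m C) + hso * halpha.
  rewrite mulrAC; exact: addr_ge0 (mulr_ge0 (quarter_norm2_ge0 _) sx0)
    (mulr_ge0 hso0 halpha0).
have [] := mx2_comparison _ _ _ _ p q hsf0 halpha0 (mulr_ge0 hsf0 hso0) dhat0 rho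
  p0 q0 pS qS.
by split; apply: cvg0_vnorm2.
Qed.
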